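(* Let $F_c:\mathbb{R}^n\to\mathbb{R}^n$ be the smoothed function defined in the context, and let $x^*$ be a solution of the system $F_c(x)=0$. Let $\{x^k\}$ be the Newton sequence $$x^{k+1}=x^k-F_c'(x^k)^{-1}F_c(x^k),\qquad k=0,1,2,\dots$$ Then there is a neighborhood of $x^*$ such that, for every starting point $x^0$ in this neighborhood, the sequence $\{x^k\}$ converges to $x^*$ with order two.
   Context: Let $M\in\mathbb{R}^{n\times n}$, $q\in\mathbb{R}^n$, and $m(\cdot):\mathbb{R}^n\to\mathbb{R}^n$ be a mapping such that $g(z)=z-m(z)$ is an invertible function on $\mathbb{R}^n$. Let $\alpha,\beta>0$ be constants, $I$ the $n\times n$ identity matrix, $\Omega=\alpha I$, $A=\beta M$, and let $c$ be a large positive integer. Absolute values, squares, square roots and addition of the scalar $e^{-c}$ are applied to vectors componentwise; thus $(x^2+e^{-c})^{1/2}=\big((x_1^2+e^{-c})^{1/2},\dots,(x_n^2+e^{-c})^{1/2}\big)^{T}$. Define $$F_c(x)=(\Omega+A)x-(\Omega-A)\,(x^2+e^{-c})^{1/2}+M\,m(z)+q,\qquad z=g^{-1}\big(\beta(|x|+x)\big).$$ (This smooths the fixed-point form of the implicit complementarity problem $z-m(z)\ge 0$, $w=Mz+q\ge 0$, $(z-m(z))^T(Mz+q)=0$.) $F_c$ is taken to be smooth, and $F_c'(x)$ denotes its Jacobian matrix. The iteration formula presupposes that $F_c'$ is invertible at the points where its inverse is used. Convergence to $x^*$ with order $p$ means $x^k\to x^*$ and $\|x^{k+1}-x^*\|=O(\|x^k-x^*\|^p)$.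 *)

(* Defs.v *)
From HB Require Import structures.
From mathcomp Require Import all_boot all_order all_algebra.
From mathcomp Require Import all_classical all_reals all_analysis.

Set Implicit Arguments.
Unset Strict Implicit.
Unset Printing Implicit Defensive.

Import Order.TTheory GRing.Theory Num.Theory.
Import numFieldNormedType.Exports.

Local Open Scope classical_set_scope.
Local Open Scope ring_scope.

(** [ginv] stands for the inverse of [g z = z - m z]; it is a parameter here
    and is tied to [m] by cancellation hypotheses where [Fc] is used. *)
Definition Fc (R : realType) (n : nat) (alpha beta : R) (M : 'M[R]_n)
    (q : 'cV[R]_n) (m ginv : 'cV[R]_n -> 'cV[R]_n) (c : nat)
    (x : 'cV[R]_n) : 'cV[R]_n :=
  let Omega : 'M[R]_n := alpha%:M in
  let A := beta *: M in
  let z := ginv (beta *: (map_mx (fun t => `|t|) x + x)) in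
  (Omega + A) *m x
  - (Omega - A) *m map_mx (fun t => Num.sqrt (t ^+ 2 + expR (- c%:R))) x
  + M *m m z + q.

(** [jacobian] of the library acts on row vectors, on the right; this is the
    column-vector version, with entries [dF_i/dx_j]. *)
Definition cjacobian (R : realType) (n : nat) (F : 'cV[R]_n -> 'cV[R]_n)
    (x : 'cV[R]_n) : 'M[R]_n :=
  \matrix_(i, j) 'D_(delta_mx j 0) (fun y : 'cV[R]_n => F y i 0) x.

(** In finite dimension, [x |-> 'd F x] is of class C^k exactly when
    [x |-> 'd F x v] is, for each direction [v]; this avoids topologizing the
    space of linear maps. *)
Fixpoint class_C (R : realType) (V W : normedModType R) (k : nat)
    (F : V -> W) : Prop :=
  match k with
  | 0 => continuous F
  | k'.+1 => (forall x, differentiable F x) /\ (forall v, class_C k' ('D_v F))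
  end.

Definition smooth (R : realType) (V W : normedModType R) (F : V -> W) : Prop :=
  forall k, class_C k F.

(** [invmx A = A] when [A] is singular, so this recursion is meaningful only
    together with the invertibility of the Jacobian at every [x k]. *)
Definition newton_seq (R : realType) (n : nat) (F : 'cV[R]_n -> 'cV[R]_n)
    (x : nat -> 'cV[R]_n) : Prop :=
  forall k, x k.+1 = x k - invmx (cjacobian F (x k)) *m F (x k).

Definition cvg_with_order (R : realType) (V : normedModType R) (p : nat)
    (x : nat -> V) (l : V) : Prop :=
  x @ \oo --> l /\
  (fun k => `|x k.+1 - l|) =O_\oo (fun k => `|x k - l| ^+ p).

(* Main.v *)
Require Import Defs.
From HB Require Import structures.
From mathcomp Require Import all_boot all_order all_algebra.
From mathcomp Require Import all_classical all_reals all_analysis.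
From mathcomp Require Import lra.

Import Order.TTheory GRing.Theory Num.Theory.
Import numFieldNormedType.Exports.

Set Implicit Arguments.
Unset Strict Implicit.
Unset Printing Implicit Defensive.

Local Open Scope classical_set_scope.
Local Open Scope ring_scope.

(** Only F in class C^2 with a nonsingular Jacobian J at the root p is used.
    Differentiability of J at p gives |J y - J p| <= K |y - p| nearby. For x
    near p, the mean value theorem, applied to each coordinate of F on the
    segment from p to x, bounds r = F x - F p - J x (x - p) by a multiple of
    |x - p|^2. The next Newton iterate x' satisfies J x (x' - p) = - r, and
    a matrix close to J p is invertible with a uniformly bounded inverse, so
    |x' - p| <= C |x - p|^2. On a ball of radius at most 1 / (2 C) the error
    is at least halved at each step, which gives convergence. *)

(** * Entrywise maximum norm of matrices and perturbation of invertible matrices *)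

Lemma ler_entry_mx_norm (R : realType) (m n : nat) (A : 'M[R]_(m, n)) i j :
  `|A i j| <= `|A|.
Proof.
rewrite [leRHS]mx_normrE.
exact: (le_bigmax _ (fun ij : 'I_m * 'I_n => `|A ij.1 ij.2|) (i, j)).
Qed.

Lemma mx_norm_le (R : realType) (m n : nat) (A : 'M[R]_(m, n)) (r : R) :
  0 <= r -> (forall i j, `|A i j| <= r) -> `|A| <= r.
Proof.
by move=> r0 Ar; rewrite [leLHS]mx_normrE; apply/bigmax_leP; split=> // -[].
Qed.

(** The maximum norm is not submultiplicative: the factor [n] counts the terms in each entry of the
    product. *)
Lemma mx_norm_mul (R : realType) (m n p : nat) (A : 'M[R]_(m, n))
    (B : 'M[R]_(n, p)) : `|A *m B| <= n%:R * `|A| * `|B|.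
Proof.
apply: mx_norm_le => [|i j]; first by rewrite !mulr_ge0.
rewrite mxE; apply: (le_trans (ler_norm_sum _ _ _)).
have -> : n%:R * `|A| * `|B| = \sum_(k < n) `|A| * `|B|.
  by rewrite sumr_const card_ord -mulrA mulr_natl.
by apply: ler_sum => k _; rewrite normrM ler_pM ?ler_entry_mx_norm.
Qed.

(** In [v = A^-1 (B v - (B - A) v)] the second term costs at most half of [|v|] when [B] is close to
    [A], and is absorbed on the left. *)
Lemma unitmx_perturbation (R : realType) (n : nat) (A : 'M[R]_n) :
  A \in unitmx ->
  exists2 b : R, 0 < b & exists2 e : R, 0 < e & forall B : 'M[R]_n,
    `|B - A| <= e -> B \in unitmx /\ forall v : 'cV[R]_n, `|v| <= b * `|B *m v|.
Proof.
move=> Au.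
(* Adding 1 here, and to [n] below, keeps the constants positive even for [n = 0]. *)
pose c : R := n%:R * `|invmx A| + 1.
have c0 : 0 < c by rewrite ltr_pwDr// mulr_ge0.
have n0 : 0 < n%:R + 1 :> R by rewrite ltr_pwDr.
exists (2 * c); first by rewrite mulr_gt0.
exists ((2 * c * (n%:R + 1))^-1); first by rewrite invr_gt0 !mulr_gt0.
move=> B BA.
have Bv (v : 'cV[R]_n) : `|v| <= 2 * c * `|B *m v|.
  have vE : v = invmx A *m (B *m v - (B - A) *m v).
    by rewrite mulmxBl opprB addrC subrK mulKmx.
  have h1 : `|v| <= c * `|B *m v - (B - A) *m v|.
    rewrite {1}vE (le_trans (mx_norm_mul _ _))// ler_wpM2r//.
    by rewrite lerDl.
  have h2 : `|(B - A) *m v| <= (2 * c)^-1 * `|v|.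
    rewrite (le_trans (mx_norm_mul _ _))// ler_wpM2r//.
    apply: (@le_trans _ _ ((n%:R + 1) * (2 * c * (n%:R + 1))^-1)).
      by rewrite ler_pM// lerDl.
    by rewrite invfM mulrCA divff ?mulr1// gt_eqF.
  have h3 := ler_normB (B *m v) ((B - A) *m v).
  have : `|v| <= c * (`|B *m v| + (2 * c)^-1 * `|v|).
    by rewrite (le_trans h1)// ler_pM2l// (le_trans h3)// lerD2l.
  rewrite mulrDr mulrA invfM mulrCA divff ?gt_eqF// mulr1.
  lra.
(* Each row of the kernel of [B^T], transposed, is a vector that [B] kills, so the bound makes it
   zero. *)
split=> //; rewrite -unitmx_tr -row_free_unit -kermx_eq0.
apply/eqP/row_matrixP => i; rewrite row0; apply: trmx_inj; apply/eqP.
rewrite trmx0 -normr_le0 (le_trans (Bv _))//.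
have -> : B *m (row i (kermx B^T))^T = (row i (kermx B^T) *m B^T)^T.
  by rewrite trmx_mul trmxK.
by rewrite -row_mul mulmx_ker row0 trmx0 normr0 mulr0.
Qed.

(** * Local estimates from differentiability *)

Lemma differentiable_lipschitz_at (R : realType) (V W : normedModType R)
    (f : V -> W) (x : V) : differentiable f x ->
  exists2 K : R, 0 < K & \forall y \near x, `|f y - f x| <= K * `|y - x|.
Proof.
move=> df.
have /linear_boundedP : bounded_near ('d f x) (nbhs (0 : V)).
  by apply: continuous_linear_bounded; apply: diff_continuous.
move=> /pinfty_ex_gt0 [r r0 fr].
(* [r] bounds the differential; the 1 pays for the little-o remainder, taken with epsilon equal to
   1. *)
exists (r + 1); first by rewrite addr_gt0.
have : forall e, 0 < e -> \forall h \near (0 : V),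
    `|(f \o shift x - (cst (f x) + 'd f x)) h| <= e * `|h|.
  by apply/eqaddoP; exact: diff_locally.
move=> /(_ 1 ltr01)/nbhs_normP[d /= d0 fd].
apply/nbhs_normP; exists d => //= y yd.
have := fd (y - x).
rewrite /= sub0r normrN distrC => /(_ yd).
rewrite -[(_ - _) (y - x)]/(f (y - x + x) - (f x + 'd f x (y - x))) subrK mul1r.
rewrite opprD addrA => h; rewrite -[f y - f x](subrK ('d f x (y - x))).
rewrite (le_trans (ler_normD _ _))// mulrDl mul1r [leRHS]addrC lerD//.
by rewrite distrC.
Qed.

Lemma derive_entry (R : realType) (V : normedModType R) (n : nat)
    (F : V -> 'cV[R]_n) (x v : V) i : derivable F x v ->
  'D_v (fun y => F y i 0) x = 'D_v F x i 0.
Proof. by move=> dF; rewrite derive_mx// mxE. Qed.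

Lemma is_derive_line (R : realType) (V W : normedModType R) (f : V -> W)
    (x h : V) (t : R) : differentiable f (x + t *: h) ->
  is_derive t 1 (fun s : R => f (x + s *: h)) ('D_h f (x + t *: h)).
Proof.
move=> df; pose l : R -> V := cst x + ( *:%R ^~ h).
have dl : is_diff t l (cst 0 + ( *:%R ^~ h)) by exact: is_diffD.
have [dfl dflE] : is_diff t (f \o l) ('d f (l t) \o (cst 0 + ( *:%R ^~ h))).
  by apply: is_diff_comp; exact: differentiableP.
apply: DeriveDef; first exact: diff_derivable dfl.
rewrite [LHS](deriveE _ dfl) dflE deriveE//=.
by congr ('d f _ _); rewrite fctE add0r scale1r.
Qed.

Section jacobian.
Context (R : realType) (n : nat) (F : 'cV[R]_n -> 'cV[R]_n).
Implicit Types x y v : 'cV[R]_n.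

Lemma derive_cjacobian x v : differentiable F x ->
  'D_v F x = cjacobian F x *m v.
Proof.
move=> dF; rewrite deriveE//.
rewrite {1}(matrix_sum_delta v) linear_sum; apply/colP => i.
rewrite summxE mxE; apply: eq_bigr => j _.
rewrite big_ord1 linearZ !mxE mulrC; congr (_ * _).
by rewrite derive_entry ?deriveE//; exact: diff_derivable.
Qed.

(** The columns of the Jacobian are directional derivatives, each Lipschitz at [x]; the sum of their
    constants serves all columns. *)
Lemma cjacobian_lipschitz_at x :
  (forall y, differentiable F y) ->
  (forall v, differentiable ('D_v F) x) ->
  exists2 K : R, 0 < K &
    \forall y \near x, `|cjacobian F y - cjacobian F x| <= K * `|y - x|.
Proof.
move=> dF dDF.
have /choice[K HK] (j : 'I_n) : exists K : R, 0 < K /\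
    \forall y \near x, `|'D_(delta_mx j 0) F y - 'D_(delta_mx j 0) F x|
      <= K * `|y - x|.
  by have [K K0 ?] := differentiable_lipschitz_at (dDF (delta_mx j 0)); exists K.
have K0 : 0 <= \sum_j K j by rewrite sumr_ge0// => j _; exact/ltW/(HK j).1.
exists (\sum_j K j + 1); first by rewrite ltr_pwDr.
have : \forall y \near x, forall j, `|'D_(delta_mx j 0) F y - 'D_(delta_mx j 0) F x|
      <= K j * `|y - x|.
  exact: filter_forall (fun j => (HK j).2).
move=> HKx; near=> y.
apply: mx_norm_le => [|i j]; first by rewrite mulr_ge0// addr_ge0.
have -> : (cjacobian F y - cjacobian F x) i j =
    ('D_(delta_mx j 0) F y - 'D_(delta_mx j 0) F x) i 0.
  by rewrite !mxE !derive_entry//; exact: diff_derivable.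
rewrite (le_trans (ler_entry_mx_norm _ _ _))//.
have : forall j, `|'D_(delta_mx j 0) F y - 'D_(delta_mx j 0) F x|
      <= K j * `|y - x| by near: y.
move=> /(_ j)/le_trans; apply; rewrite ler_wpM2r// (bigD1 j)//= -addrA lerDl.
by rewrite addr_ge0// sumr_ge0// => k _; exact/ltW/(HK k).1.
Unshelve. all: end_near. Qed.

(** The mean value theorem is scalar, so [t] depends on [i]; this suffices for a norm that is
    bounded entry by entry. *)
Lemma mean_value_entry x y i : (forall z, differentiable F z) ->
  exists2 t : R, 0 <= t <= 1 &
    (F y - F x) i 0 = (cjacobian F (x + t *: (y - x)) *m (y - x)) i 0.
Proof.
move=> dF; pose h : 'cV[R]_n := y - x.
pose phi t := F (x + t *: h) i 0.
have dphi (t : R) : is_derive t 1 phi ((cjacobian F (x + t *: h) *m h) i 0).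
  have [dl El] := is_derive_line (dF (x + t *: h)).
  rewrite -(derive_cjacobian h (dF _)) -El -(derive_entry i dl).
  by apply: DeriveDef => //; exact: ((derivable_mxP _ _ _).1 dl i 0).
have [|t] := MVT_segment ler01 (fun t _ => dphi t).
  apply: continuous_subspaceT => t; apply: differentiable_continuous.
  by apply/derivable1_diffP; have [] := dphi t.
rewrite in_itv/= => t01; rewrite /phi scale0r addr0 scale1r subrKC subr0 mulr1.
by move=> E; exists t => //; rewrite -E !mxE.
Qed.

End jacobian.

(** * Quadratic error bound for one Newton step and convergence of the iteration *)

Lemma newton_step (R : realType) (n : nat) (F : 'cV[R]_n -> 'cV[R]_n) xs :
  (forall x, differentiable F x) -> (forall v, differentiable ('D_v F) xs) ->
  F xs = 0 -> cjacobian F xs \in unitmx ->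
  exists2 C : R, 0 < C & \forall x \near xs, cjacobian F x \in unitmx /\
    `|x - invmx (cjacobian F x) *m F x - xs| <= C * `|x - xs| ^+ 2.
Proof.
move=> dF dDF F0 Ju.
have [b b0 [e e0 Hb]] := unitmx_perturbation Ju.
have [K K0 /nbhs_normP[d /= d0 HK]] := cjacobian_lipschitz_at dF dDF.
have n0 : 0 < n%:R + 1 :> R by rewrite ltr_pwDr.
exists (b * ((n%:R + 1) * (2 * K))); first by rewrite !mulr_gt0.
(* Radius [d] gives the Lipschitz estimate; [e / K] then puts the Jacobian at [x] within [e] of the
   one at [xs]. *)
have de0 : 0 < Num.min d (e / K) by rewrite lt_min d0 divr_gt0.
apply/nbhs_normP; exists (Num.min d (e / K)) => //= x /=.
rewrite lt_min distrC => /andP[xd xe].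
have Jx : `|cjacobian F x - cjacobian F xs| <= K * `|x - xs|.
  by apply: HK; rewrite /= distrC.
have [] := Hb (cjacobian F x).
  by rewrite (le_trans Jx)// mulrC -ler_pdivlMr// ltW.
move=> xu Hx; split=> //.
rewrite (le_trans (Hx _))// -mulrA ler_pM2l//.
have -> : cjacobian F x *m (x - invmx (cjacobian F x) *m F x - xs) =
    - (F x - F xs - cjacobian F x *m (x - xs)).
  by rewrite F0 subr0 addrAC mulmxBr mulKVmx// opprB.
rewrite normrN; apply: mx_norm_le => [|i j]; first by rewrite !mulr_ge0// ltW.
rewrite (ord1 j) mxE.
have [t /andP[t0 t1] ->] := mean_value_entry xs x i dF.
set y := xs + _.
(* The intermediate point lies on the segment from [xs] to [x], so the estimate at [xs] covers it
   too. *)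
have yx : `|y - xs| <= `|x - xs|.
  by rewrite /y addrAC subrr add0r normrZ ger0_norm// ler_piMl.
have Jy : `|cjacobian F y - cjacobian F xs| <= K * `|x - xs|.
  rewrite (le_trans (HK y _)) ?ler_pM2l//=.
  by rewrite distrC (le_lt_trans yx).
have -> : (cjacobian F y *m (x - xs)) i 0 +
    (- (cjacobian F x *m (x - xs))) i 0 =
    ((cjacobian F y - cjacobian F x) *m (x - xs)) i 0.
  by rewrite mulmxBl !mxE.
rewrite (le_trans (ler_entry_mx_norm _ _ _))//.
rewrite (le_trans (mx_norm_mul _ _))//.
rewrite expr2 !mulrA ler_wpM2r// -mulrA -(mulrA (_ + 1)) ler_pM// ?lerDl//.
(* The Lipschitz estimate is centred at [xs], so the two Jacobians are compared through the one
   there; hence [2 * K]. *)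
rewrite -(subrK (cjacobian F xs) (cjacobian F y)) -addrA.
rewrite (le_trans (ler_normD _ _))// -?mulrA mulr_natl mulr2n.
by apply: lerD; [exact: Jy | rewrite distrC; exact: Jx].
Qed.

(** The predicate [P] carries the invertibility of the Jacobian along the whole orbit. *)
Lemma quadratic_cvg (R : realType) (V : normedModType R) (l : V) (f : V -> V)
    (P : V -> Prop) (C : R) : 0 < C ->
  (\forall x \near l, P x /\ `|f x - l| <= C * `|x - l| ^+ 2) ->
  exists U : set V, nbhs l U /\ forall x : nat -> V,
    U (x 0%N) -> (forall k, x k.+1 = f (x k)) ->
    (forall k, P (x k)) /\ cvg_with_order 2 x l.
Proof.
move=> C0 /nbhs_normP[d /= d0 Hd].
pose r := Num.min d (2 * C)^-1.
have r0 : 0 < r by rewrite lt_min d0 invr_gt0 mulr_gt0.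
exists (fun x => `|x - l| < r); split.
  by apply/nbhs_normP; exists r => //= x /=; rewrite distrC.
move=> x x0 xS.
(* Since [r <= (2 * C)^-1], one factor [C * |x k - l|] of the quadratic bound is at most one
   half. *)
have half k : `|x k - l| < r -> `|x k.+1 - l| <= 2^-1 * `|x k - l|.
  rewrite lt_min => /andP[xd xC].
  have [_] := Hd (x k) ltac:(by rewrite /= distrC).
  rewrite -xS => /le_trans; apply; rewrite expr2 mulrA ler_wpM2r//.
  apply: (@le_trans _ _ (C * (2 * C)^-1)); first by rewrite ler_pM2l// ltW.
  by rewrite invfM mulrCA divff ?gt_eqF// mulr1.
have xr k : `|x k - l| < r.
  elim: k => // k IH; rewrite (le_lt_trans (half _ IH))//.
  by have := normr_ge0 (x k - l); lra.
have xd k : P (x k) /\ `|x k.+1 - l| <= C * `|x k - l| ^+ 2.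
  rewrite xS; apply: Hd; rewrite /= distrC.
  by have := xr k; rewrite lt_min => /andP[].
split; first by move=> k; have [] := xd k.
split; last first.
  apply/eqO_exP; exists C => //; near=> k => /=.
  by rewrite normr_id normrX normr_id; have [] := xd k.
have geo k : `|x k - l| <= r * 2^-1 ^+ k.
  elim: k => [|k IH]; first by rewrite expr0 mulr1 ltW.
  by rewrite (le_trans (half k _))// exprS mulrCA ler_wpM2l.
apply/subr_cvg0/norm_cvg0P.
apply: (@squeeze_cvgr _ _ _ _ (cst 0) (geometric r 2^-1)).
- by near=> k; rewrite normr_ge0 geo.
- exact: cvg_cst.
- by apply: cvg_geometric; rewrite ger0_norm ?invr_ge0// invf_lt1 ?ltr1n.
Unshelve. all: end_near. Qed.

Unset Implicit Arguments.

Theorem theorem1 (R : realType) (n : nat) (M : 'M[R]_n) (q : 'cV[R]_n)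
    (m ginv : 'cV[R]_n -> 'cV[R]_n) (alpha beta : R) (c : nat)
    (xstar : 'cV[R]_n)
    (g_ginv : cancel (fun z => z - m z) ginv)
    (ginv_g : cancel ginv (fun z => z - m z))
    (alpha_gt0 : 0 < alpha) (beta_gt0 : 0 < beta) (c_gt0 : (0 < c)%N)
    (F_smooth : smooth (Fc alpha beta M q m ginv c))
    (F_root : Fc alpha beta M q m ginv c xstar = 0)
    (J_unit : cjacobian (Fc alpha beta M q m ginv c) xstar \in unitmx) :
  exists U : set 'cV[R]_n, nbhs xstar U /\
    forall x : nat -> 'cV[R]_n,
      U (x 0%N) -> newton_seq (Fc alpha beta M q m ginv c) x ->
      (forall k, cjacobian (Fc alpha beta M q m ginv c) (x k) \in unitmx) /\
      cvg_with_order 2 x xstar.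
Proof.
(* Class C^2 unfolds to differentiability of the map and class C^1 of each directional
   derivative. *)
have [dF dDF] := F_smooth 2%N.
have [C C0 HC] := newton_step dF (fun v => (dDF v).1 xstar) F_root J_unit.
exact: quadratic_cvg C0 HC.
Qed.
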